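(* Define operations $\underline{\triangleright},\overline{\triangleright}:X\times X\to X$ on the ring $X$ by $$x\ \underline{\triangleright}\ y=s^{-1}x-s^{-1}(u+t)y,\qquad x\ \overline{\triangleright}\ y=s^{-1}(1-u)x-s^{-1}t\,y\qquad (x,y\in X).$$ Then $(X;\underline{\triangleright},\overline{\triangleright})$ is a biquandle.
   Context: Ring $X$. Let $\mathbb{Z}\langle s,s^{-1},u,t\rangle$ be the free non-commutative unital $\mathbb{Z}$-algebra on the four letters $s,s^{-1},u,t$, graded by $\deg(s)=\deg(s^{-1})=0$, $\deg(u)=\deg(t)=1$. Let $R$ be its degree completion: elements are formal sums $\sum_{d\ge 0}r_d$ with $r_d$ a finite $\mathbb{Z}$-linear combination of words of degree $d$. For $k\ge 0$ let $G^k\subset R$ be the two-sided ideal of elements involving only monomials of degree $\ge k$; the $G^k$ define the topology of $R$. For $A\in G^1$, $(1-A)^{-1}$ denotes $1+A+A^2+\cdots$ (so $(1+t)^{-1}=1-t+t^2-\cdots$). Let $J$ be the closure of the two-sided ideal of $R$ generated by $ss^{-1}-1$, $s^{-1}s-1$, $su-us$ and $sts^{-1}-(1-u)t(1+t)^{-1}$. Set $X=R/J$; the images of $s,s^{-1},u,t$ in $X$ are denoted by the same letters. Biquandle. A biquandle $(B;\underline{\triangleright},\overline{\triangleright})$ is a set $B$ with two operations $\underline{\triangleright},\overline{\triangleright}:B\times B\to B$ such that: (i) $x\,\underline{\triangleright}\,x=x\,\overline{\triangleright}\,x$ for all $x\in B$; (ii) for all $y\in B$ the maps $x\mapsto x\,\underline{\triangleright}\,y$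 and $x\mapsto x\,\overline{\triangleright}\,y$ from $B$ to $B$ are invertible; (iii) the map $S:B\times B\to B\times B$, $S(x,y)=(y\,\overline{\triangleright}\,x,\ x\,\underline{\triangleright}\,y)$, is invertible; (iv) for all $x,y,z\in B$: $(x\,\underline{\triangleright}\,y)\,\underline{\triangleright}\,(z\,\underline{\triangleright}\,y)=(x\,\underline{\triangleright}\,z)\,\underline{\triangleright}\,(y\,\overline{\triangleright}\,z)$, $(x\,\underline{\triangleright}\,y)\,\overline{\triangleright}\,(z\,\underline{\triangleright}\,y)=(x\,\overline{\triangleright}\,z)\,\underline{\triangleright}\,(y\,\overline{\triangleright}\,z)$, $(x\,\overline{\triangleright}\,y)\,\overline{\triangleright}\,(z\,\overline{\triangleright}\,y)=(x\,\overline{\triangleright}\,z)\,\overline{\triangleright}\,(y\,\underline{\triangleright}\,z)$. *)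

(* Defs.v *)
From HB Require Import structures.
From mathcomp Require Import all_boot all_order all_algebra.
From mathcomp Require Import all_classical.
From mathcomp Require Import topology.

Set Implicit Arguments.
Unset Strict Implicit.
Unset Printing Implicit Defensive.

Import GRing.Theory.
Local Open Scope classical_set_scope.
Local Open Scope ring_scope.

Inductive letter := Ls | Lsi | Lu | Lt.

HB.instance Definition _ := gen_eqMixin letter.
HB.instance Definition _ := gen_choiceMixin letter.

Definition word := seq letter.

Definition deg (w : word) : nat :=
  count (fun a => match a with Ls | Lsi => false | Lu | Lt => true end) w.

(* Families of integer coefficients indexed by words form the ring
   Z<<s,s^-1,u,t>> of all non-commutative power series, with the product
   (f g)(w) = \sum_(w = w1 w2) f w1 * g w2. There are infinitely many words in
   each degree, since s and s^-1 have degree 0; the degree completion R of the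
   free algebra is the subring of the series that have finitely many nonzero
   coefficients in each degree. *)
Definition conv (f g : word -> int) (w : word) : int :=
  \sum_(i < (size w).+1) f (take i w) * g (drop i w).

Definition unit_series (w : word) : int := (w == [::])%:R.

Definition degreewise_finite (f : word -> int) : Prop :=
  forall d, finite_set [set w | deg w = d /\ f w != 0].

Lemma conv_nil f g : conv f g [::] = f [::] * g [::].
Proof. by rewrite /conv big_ord1. Qed.

Lemma conv_cons f g a w :
  conv f g (a :: w) = f [::] * g (a :: w) + conv (fun v => f (a :: v)) g w.
Proof. by rewrite /conv big_ord_recl. Qed.

Lemma convDl f1 f2 g : conv (f1 \+ f2) g = conv f1 g \+ conv f2 g.
Proof.
apply/funext => w; rewrite /conv /= -big_split /=.
by apply: eq_bigr => i _; rewrite mulrDl.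
Qed.

Lemma convDr f g1 g2 : conv f (g1 \+ g2) = conv f g1 \+ conv f g2.
Proof.
apply/funext => w; rewrite /conv /= -big_split /=.
by apply: eq_bigr => i _; rewrite mulrDr.
Qed.

Lemma convZl c f g : conv (fun w => c * f w) g = (fun w => c * conv f g w).
Proof.
apply/funext => w; rewrite /conv mulr_sumr.
by apply: eq_bigr => i _; rewrite mulrA.
Qed.

Lemma convA : associative conv.
Proof.
move=> f g h; apply/funext => w; elim: w f g h => [|a w IH] f g h.
  by rewrite !conv_nil mulrA.
rewrite !conv_cons IH conv_nil mulrDr mulrA -addrA; congr (_ + _).
have -> : (fun v => conv f g (a :: v)) =
    (fun v => f [::] * g (a :: v)) \+ conv (fun v => f (a :: v)) g.
  by apply/funext => v; rewrite conv_cons.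
by rewrite convDl /= convZl.
Qed.

Lemma conv1l : left_id unit_series conv.
Proof.
move=> f; apply/funext => w; rewrite /conv big_ord_recl /= take0 drop0 mul1r.
rewrite big1 ?addr0 // => i _; case: w i => [|a w] i /=; first by case: i.
by rewrite /unit_series mul0r.
Qed.

Lemma conv1r : right_id unit_series conv.
Proof.
move=> f; apply/funext => w; rewrite /conv big_ord_recr /=.
rewrite take_size drop_size mulr1 big1 ?add0r // => i _.
rewrite /unit_series -size_eq0 size_drop subn_eq0 leqNgt ltn_ord.
by rewrite mulr0.
Qed.

Lemma deg_cat v w : deg (v ++ w) = (deg v + deg w)%N.
Proof. exact: count_cat. Qed.

Lemma degreewise_finite_conv f g :
  degreewise_finite f -> degreewise_finite g -> degreewise_finite (conv f g).
Proof.
move=> ff fg d.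
pose S (h : word -> int) i : set word := [set w | deg w = i /\ h w != 0].
pose U : set word :=
  \bigcup_(i in `I_d.+1) [set v ++ w | v in S f i & w in S g (d - i)%N].
apply: (@sub_finite_set _ _ U).
  move=> w [dw cw].
  have [i fgi] : exists i : 'I_(size w).+1, f (take i w) * g (drop i w) != 0.
    apply/existsP; apply: contraNT cw => /existsPn h.
    by apply/eqP/big1 => i _; apply/eqP; move: (h i); rewrite negbK.
  have /andP[fi gi] : (f (take i w) != 0) && (g (drop i w) != 0).
    by rewrite -negb_or -mulf_eq0.
  have dE : d = (deg (take i w) + deg (drop i w))%N.
    by rewrite -deg_cat cat_take_drop.
  exists (deg (take i w)); first by rewrite /= ltnS dE leq_addr.
  exists (take i w) => //; exists (drop i w); last exact: cat_take_drop.
  by split => //; rewrite dE addKn.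
apply: bigcup_finite; first exact: finite_II.
by move=> i _; apply: finite_image2; [exact: ff|exact: fg].
Qed.

Definition degreewise_finiteb (f : word -> int) : bool :=
  `[< degreewise_finite f >].

Record R := MkR { coef :> word -> int; coefP : degreewise_finiteb coef }.

HB.instance Definition _ := [isSub for coef].
HB.instance Definition _ := [Equality of R by <:].
HB.instance Definition _ := [Choice of R by <:].

Lemma degreewise_finite_zmod_closed :
  zmod_closed degreewise_finiteb.
Proof.
split.
  apply/asboolP => d; apply: (@sub_finite_set _ _ set0) => // w [_].
  by rewrite eqxx.
move=> f g /asboolP ff /asboolP fg; apply/asboolP => d.
apply: (@sub_finite_set _ _ ([set w | deg w = d /\ f w != 0] `|`
                             [set w | deg w = d /\ g w != 0])); last first.
  by rewrite finite_setU.
move=> w [dw nz].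
have [f0|f0] := eqVneq (f w) 0; last by left.
right; split=> //; apply: contraNN nz => /eqP g0.
by rewrite /= -[(f - g) w]/(f w - g w) f0 g0 subr0.
Qed.

HB.instance Definition _ := GRing.isZmodClosed.Build (word -> int)
  degreewise_finiteb degreewise_finite_zmod_closed.
HB.instance Definition _ := [SubChoice_isSubZmodule of R by <:].

Lemma degreewise_finite_unit : degreewise_finite unit_series.
Proof.
move=> d; apply: (@sub_finite_set _ _ [set [::]]) => // w [_].
by rewrite /unit_series; case: (w =P [::]) => [->|]; rewrite ?eqxx.
Qed.

Lemma degreewise_finite_coef (a : R) : degreewise_finite a.
Proof. exact/asboolP/coefP. Qed.

Definition oneR : R := MkR (asboolT degreewise_finite_unit).
Definition mulR (a b : R) : R :=
  MkR (asboolT (degreewise_finite_conv (degreewise_finite_coef a)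
                                       (degreewise_finite_coef b))).

Lemma mulRA : associative mulR.
Proof. by move=> a b c; apply/val_inj/convA. Qed.

Lemma mulR1l : left_id oneR mulR.
Proof. by move=> a; apply/val_inj/conv1l. Qed.

Lemma mulR1r : right_id oneR mulR.
Proof. by move=> a; apply/val_inj/conv1r. Qed.

Lemma mulRDl : left_distributive mulR +%R.
Proof. by move=> a b c; apply/val_inj/convDl. Qed.

Lemma mulRDr : right_distributive mulR +%R.
Proof. by move=> a b c; apply/val_inj/convDr. Qed.

HB.instance Definition _ :=
  GRing.Zmodule_isPzRing.Build R mulRA mulR1l mulR1r mulRDl mulRDr.

Lemma coefD (a b : R) w : (a + b) w = a w + b w.
Proof. by []. Qed.

Lemma coefN (a : R) w : (- a) w = - a w.
Proof. by []. Qed.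

Lemma coefB (a b : R) w : (a - b) w = a w - b w.
Proof. by []. Qed.

Lemma coefM (a b : R) w : (a * b) w = conv a b w.
Proof. by []. Qed.

Lemma degreewise_finite_monom (v : word) :
  degreewise_finite (fun w => (w == v)%:R).
Proof.
move=> d; apply: (@sub_finite_set _ _ [set v]) => // w [_] /=.
by case: (w =P v) => [->|]; rewrite ?eqxx.
Qed.

Definition monom (v : word) : R := MkR (asboolT (degreewise_finite_monom v)).

Lemma monomM v w : monom v * monom w = monom (v ++ w).
Proof.
apply/val_inj/funext => x; rewrite /= /conv.
have [->|ne] := eqVneq x (v ++ w); last first.
  rewrite big1 // => i _; have [tE|_] := eqVneq (take i x) v; last first.
    by rewrite mul0r.
  have [dE|_] := eqVneq (drop i x) w; last by rewrite mulr0.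
  by move: ne; rewrite -tE -dE cat_take_drop eqxx.
have lt : (size v < (size (v ++ w)).+1)%N by rewrite size_cat ltnS leq_addr.
rewrite (bigD1 (Ordinal lt)) //= take_size_cat // drop_size_cat // !eqxx mulr1.
rewrite big1 ?addr0 // => i ni.
case: eqP => [tE|]; last by rewrite mul0r.
case/eqP: ni; apply: val_inj => /=; rewrite -[in RHS]tE size_takel //.
by rewrite -ltnS.
Qed.

Lemma monom1 : monom [::] = 1.
Proof. exact: val_inj. Qed.

Definition G (k : nat) : set R := [set a : R | forall w, a w != 0 -> (k <= deg w)%N].

Lemma G0 k : G k 0.
Proof. by move=> w; rewrite eqxx. Qed.

Lemma GB k a b : G k a -> G k b -> G k (a - b).
Proof.
move=> ha hb w; rewrite coefB => h.
have [a0|/ha//] := eqVneq (a w) 0; apply: hb.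
by apply: contraNN h => /eqP ->; rewrite a0 subr0.
Qed.

Lemma GN k a : G k a -> G k (- a).
Proof. by move=> ha; rewrite -[- a]add0r; apply: GB => //; exact: G0. Qed.

Lemma GD k a b : G k a -> G k b -> G k (a + b).
Proof. by move=> ha hb; rewrite -[b]opprK; apply/GB/GN. Qed.

Lemma GM i j a b : G i a -> G j b -> G (i + j)%N (a * b).
Proof.
move=> ha hb w; rewrite coefM; apply: contraNT; rewrite -ltnNge => dw.
apply/eqP/big1 => l _; have [->|al] := eqVneq (a (take l w)) 0.
  by rewrite mul0r.
have [->|bl] := eqVneq (b (drop l w)) 0; first by rewrite mulr0.
have := leq_add (ha _ al) (hb _ bl).
by rewrite -deg_cat cat_take_drop leqNgt dw.
Qed.

Lemma GT a : G 0 a.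
Proof. by []. Qed.

Lemma GMl k a b : G k b -> G k (a * b).
Proof. exact: (GM (@GT a)). Qed.

Lemma GMr k a b : G k a -> G k (a * b).
Proof. by move=> ha; rewrite -[k]addn0; apply: GM. Qed.

Lemma GX a n : G 1 a -> G n (a ^+ n).
Proof.
by move=> a1; elim: n => [|n IH]; [exact: GT|rewrite exprS -add1n; exact: GM].
Qed.

Lemma G_le j k a : (j <= k)%N -> G k a -> G j a.
Proof. by move=> jk ha w /ha; exact: leq_trans. Qed.

Definition nbhsR (a : R) : set_system R :=
  filter_from setT (fun k => [set b | G k (b - a)]).

HB.instance Definition _ := hasNbhs.Build R nbhsR.

Lemma nbhsR_filter (a : R) : ProperFilter (nbhs a).
Proof.
apply: filter_from_proper; last by move=> k _; exists a; rewrite /= subrr; exact: G0.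
apply: filter_from_filter; first by exists 0%N.
move=> i j _ _; exists (maxn i j) => // b h.
by split; apply: G_le h; rewrite (leq_maxl, leq_maxr).
Qed.

Lemma nbhsR_singleton (a : R) (A : set R) : nbhs a A -> A a.
Proof. by move=> [k _]; apply; rewrite /= subrr; exact: G0. Qed.

Lemma nbhsR_nbhs (a : R) (A : set R) : nbhs a A -> nbhs a (nbhs^~ A).
Proof.
move=> [k _ sA]; exists k => // b ba; exists k => // c cb; apply: sA => /=.
by rewrite -(subrK b c) -addrA; apply: GD.
Qed.

HB.instance Definition _ :=
  Nbhs_isNbhsTopological.Build R nbhsR_filter nbhsR_singleton nbhsR_nbhs.

(* (1 - a)^-1 = 1 + a + a^2 + ... for a in G 1: then a^n lies in G n, so only
   the terms n <= deg w contribute to the coefficient of w. For a outside G 1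
   the value is meaningless. *)
Definition geom_coef (a : R) (w : word) : int :=
  (\sum_(n < (deg w).+1) a ^+ n) w.

Lemma degreewise_finite_geom a : degreewise_finite (geom_coef a).
Proof.
move=> d; have := @degreewise_finite_coef (\sum_(n < d.+1) a ^+ n) d.
apply: sub_finite_set => w [dw nz]; split => //.
by move: nz; rewrite /geom_coef dw.
Qed.

Definition geom (a : R) : R := MkR (asboolT (degreewise_finite_geom a)).

Lemma geom_trunc a n : G 1 a -> G n (\sum_(k < n) a ^+ k - geom a).
Proof.
move=> a1 w; apply: contraNT; rewrite -ltnNge => dw.
rewrite coefB [geom a w]/(geom_coef a w) /geom_coef -coefB.
rewrite -(subnKC dw) big_split_ord /= addrAC subrr add0r.
set r := \sum_(i < _) _; have Gr : G (deg w).+1 r.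
  apply: big_ind => [||i _]; [exact: G0|exact: GD|].
  by rewrite exprD; apply/GMr/GX.
by apply/eqP; have [//|/Gr] := eqVneq (r w) 0; rewrite ltnn.
Qed.

Lemma cvg_geom a : G 1 a -> (\sum_(k < n) a ^+ k) @[n --> \oo] --> geom a.
Proof.
move=> a1 A [k _ sA]; exists k => // n /= kn; apply: sA => /=.
exact/(G_le kn)/geom_trunc.
Qed.

Definition two_sided_ideal (T : pzRingType) (I : set T) : Prop :=
  [/\ I 0, forall a b, I a -> I b -> I (a - b)
    & forall r a r', I a -> I (r * a * r')].

Definition ideal_gen (T : pzRingType) (E : set T) : set T :=
  smallest (@two_sided_ideal T) E.

Lemma ideal_gen_ideal (T : pzRingType) (E : set T) :
  two_sided_ideal (ideal_gen E).
Proof.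
split=> [I [[I0 _ _] _]//|a b ha hb I [hI EI]|r a r' ha I [hI EI]].
- by case: (hI) => _ h _; apply: h; [exact: (ha I)|exact: (hb I)].
- by case: (hI) => _ _ h; apply/h/(ha I).
Qed.

Lemma closureRP (A : set R) a :
  closure A a <-> forall k, exists2 b, A b & G k (b - a).
Proof.
split=> [cA k|h B [k _ sB]].
  have [|b [Ab /= ba]] := cA [set b | G k (b - a)]; first by exists k.
  by exists b.
by have [b Ab ba] := h k; exists b; split => //; exact: sB.
Qed.

Lemma closureR_ideal (I : set R) :
  two_sided_ideal I -> two_sided_ideal (closure I).
Proof.
move=> [I0 IB IM]; split=> [|a b|r a r']; first exact: subset_closure.
- move=> /closureRP ha /closureRP hb; apply/closureRP => k.
  have [a' Ia' aa'] := ha k; have [b' Ib' bb'] := hb k.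
  exists (a' - b'); first exact: IB.
  by rewrite opprD addrACA -opprD; exact: GB.
- move=> /closureRP ha; apply/closureRP => k; have [a' Ia' aa'] := ha k.
  exists (r * a' * r'); first exact: IM.
  by rewrite -mulrBl -mulrBr; apply/GMr/GMl.
Qed.

Definition Rs : R := monom [:: Ls].
Definition Rsi : R := monom [:: Lsi].
Definition Ru : R := monom [:: Lu].
Definition Rt : R := monom [:: Lt].

(* [geom (- Rt)] is (1 + t)^-1. *)
Definition relators : set R :=
  [set Rs * Rsi - 1; Rsi * Rs - 1; Rs * Ru - Ru * Rs;
       Rs * Rt * Rsi - (1 - Ru) * Rt * geom (- Rt)].

Definition J : set R := closure (ideal_gen relators).

Lemma J_ideal : two_sided_ideal J.
Proof. exact/closureR_ideal/ideal_gen_ideal. Qed.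

Definition Jb (a : R) : bool := `[< J a >].

Lemma Jb_zmod_closed : zmod_closed Jb.
Proof.
have [J0 JB _] := J_ideal; split; first exact/asboolP.
by move=> a b /asboolP ha /asboolP hb; apply/asboolP/JB.
Qed.

HB.instance Definition _ := GRing.isZmodClosed.Build R Jb Jb_zmod_closed.

(* The library's quotient of a ring by an ideal is restricted to commutative
   rings, so only the quotient group R / J comes from it. *)
Definition X : Type := Quotient.quot (GRing.ZmodClosed.clone R Jb _).

HB.instance Definition _ := GRing.Zmodule.on X.

Definition toX (a : R) : X := \pi_(Quotient.quot (GRing.ZmodClosed.clone R Jb _))%qT a.

Lemma toX_surj (x : X) : exists a, x = toX a.
Proof. by exists (repr x); rewrite /toX reprK. Qed.

Lemma toX_eq a b : toX a = toX b <-> J (a - b).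
Proof.
split=> [/eqP|h]; rewrite /toX; last apply/eqP.
  by rewrite -Quotient.idealrBE => /asboolP.
by rewrite -Quotient.idealrBE; apply/asboolP.
Qed.

Lemma toX_zmod_morphism : zmod_morphism toX.
Proof. by move=> a b; rewrite /toX raddfB. Qed.

Definition mulX (x y : X) : X := toX (repr x * repr y).

Lemma toX_mul a b : toX (a * b) = mulX (toX a) (toX b).
Proof.
have [_ _ JM] := J_ideal; apply/toX_eq; set a' := repr _; set b' := repr _.
have ha : J (a - a') by apply/toX_eq; rewrite /toX reprK.
have hb : J (b - b') by apply/toX_eq; rewrite /toX reprK.
have -> : a * b - a' * b' = 1 * (a - a') * b - a' * (b' - b) * 1.
  by rewrite mul1r mulr1 mulrBl mulrBr opprB addrA subrK.
have [J0 JB _] := J_ideal; apply: (JB); apply: JM => //.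
by rewrite -opprB -[- _]add0r; exact: JB.
Qed.

Lemma mulXA : associative mulX.
Proof.
move=> x y z; have [a ->] := toX_surj x; have [b ->] := toX_surj y.
by have [c ->] := toX_surj z; rewrite -!toX_mul mulrA.
Qed.

Lemma mulX1l : left_id (toX 1) mulX.
Proof. by move=> x; have [a ->] := toX_surj x; rewrite -toX_mul mul1r. Qed.

Lemma mulX1r : right_id (toX 1) mulX.
Proof. by move=> x; have [a ->] := toX_surj x; rewrite -toX_mul mulr1. Qed.

Lemma toX_add a b : toX (a + b) = toX a + toX b.
Proof. by rewrite /toX raddfD. Qed.

Lemma mulXDl : left_distributive mulX +%R.
Proof.
move=> x y z; have [a ->] := toX_surj x; have [b ->] := toX_surj y.
by have [c ->] := toX_surj z; rewrite -toX_add -!toX_mul mulrDl toX_add.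
Qed.

Lemma mulXDr : right_distributive mulX +%R.
Proof.
move=> x y z; have [a ->] := toX_surj x; have [b ->] := toX_surj y.
by have [c ->] := toX_surj z; rewrite -toX_add -!toX_mul mulrDr toX_add.
Qed.

HB.instance Definition _ :=
  GRing.Zmodule_isPzRing.Build X mulXA mulX1l mulX1r mulXDl mulXDr.

HB.instance Definition _ := GRing.isZmodMorphism.Build R X toX toX_zmod_morphism.

Lemma toX_monoid_morphism : monoid_morphism toX.
Proof. by split=> // a b; rewrite toX_mul. Qed.

HB.instance Definition _ := GRing.isMonoidMorphism.Build R X toX toX_monoid_morphism.

Definition Xs : X := toX Rs.
Definition Xsi : X := toX Rsi.
Definition Xu : X := toX Ru.
Definition Xt : X := toX Rt.

Record biquandle (B : Type) (under over : B -> B -> B) : Prop := Biquandle {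
  biquandle_diag : forall x, under x x = over x x;
  biquandle_under_bij : forall y, bijective (under^~ y);
  biquandle_over_bij : forall y, bijective (over^~ y);
  biquandle_S_bij : bijective (fun p : B * B => (over p.2 p.1, under p.1 p.2));
  biquandle_under_under : forall x y z,
    under (under x y) (under z y) = under (under x z) (over y z);
  biquandle_under_over : forall x y z,
    over (under x y) (under z y) = under (over x z) (over y z);
  biquandle_over_over : forall x y z,
    over (over x y) (over z y) = over (over x z) (under y z) }.

(* Main.v *)
Require Import Defs.
From mathcomp Require Import all_boot all_algebra.
From mathcomp Require Import boolp classical_sets topology.
Import GRing.Theory.
Local Open Scope ring_scope.

(** Write [p] for [s^-1].  Both operations are linear, [x under y = a x - b y]
    and [x over y = c x - d y], with [a = p], [b = p (u + t)], [c = p (1 - u)],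
    [d = p t].  The diagonal axiom says [a + d = b + c]; given it, comparing
    coefficients shows that the three exchange laws amount to [c a = a c],
    [b (a + d) = a b] and [d (a + d) = c d].  In [X] these follow from
    [s u = u s] and [t p (1 + t) = p (1 - u) t].  The bijectivity axioms hold
    because [a], [c] and the Schur complement
    [c - d a^-1 b = p (1 + t) (1 - u - t)] are invertible, by the geometric
    series. *)

Definition invertible {T : pzRingType} (a : T) : Prop :=
  exists2 b, a * b = 1 & b * a = 1.

Lemma invertibleM {T : pzRingType} (a b : T) :
  invertible a -> invertible b -> invertible (a * b).
Proof.
move=> [a' aa' a'a] [b' bb' b'b]; exists (b' * a').
- by rewrite mulrA -(mulrA a) bb' mulr1.
- by rewrite mulrA -(mulrA b') a'a mulr1.
Qed.

Lemma invertible_rmorph {T U : pzRingType} (f : {rmorphism T -> U}) (a : T) :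
  invertible a -> invertible (f a).
Proof.
by move=> [b ab ba]; exists (f b); rewrite -rmorphM ?ab ?ba rmorph1.
Qed.

Lemma bijective_affine {T : pzRingType} (a b : T) :
  invertible a -> bijective (fun x => a * x - b).
Proof.
move=> [a' aa' a'a]; exists (fun x => a' * (x + b)) => x.
- by rewrite subrK mulrA a'a mul1r.
- by rewrite mulrA aa' mul1r addrK.
Qed.

(** To find the preimage of [(v, w)], the second coordinate gives [x = a' * (w + b * y)].
    Substituting this in the first leaves [(c - d * a' * b) * y = v + d * a' * w], which [Y]
    solves. *)
Lemma bijective_2x2 {T : pzRingType} (a a' b c d : T) :
  a * a' = 1 -> a' * a = 1 -> invertible (c - d * a' * b) ->
  bijective (fun p : T * T => (c * p.2 - d * p.1, a * p.1 - b * p.2)).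
Proof.
move=> aa' a'a [e' ee' e'e].
pose Y (q : T * T) := e' * (q.1 + d * a' * q.2).
exists (fun q => (a' * (q.2 + b * Y q), Y q)) => [[x y]|[v w]] /=.
  have -> : Y (c * y - d * x, a * x - b * y) = y.
    rewrite /Y /= mulrBr -(mulrA d) !mulrA -(mulrA d) a'a mulr1.
    by rewrite addrA subrK -mulrBl mulrA e'e mul1r.
  by rewrite subrK mulrA a'a mul1r.
have : (c - d * a' * b) * Y (v, w) = v + d * a' * w by rewrite mulrA ee' mul1r.
move: (Y _) => y yE; rewrite !mulrA aa' mul1r addrK; congr (_, _).
by rewrite mulrDr mulrA opprD addrCA addrC -mulrBl yE addrK.
Qed.

Lemma linear_biquandle {T : pzRingType} (a a' b c d : T) :
  a * a' = 1 -> a' * a = 1 -> invertible c -> invertible (c - d * a' * b) ->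
  a + d = b + c -> c * a = a * c ->
  b * (a + d) = a * b -> d * (a + d) = c * d ->
  biquandle (fun x y : T => a * x - b * y) (fun x y : T => c * x - d * y).
Proof.
move=> aa' a'a cV eV adE caC bE dE.
(* Each exchange law yields one identity from the coefficients of [y] and one from those of [z]:
   [ab1], [ab2] for the first law, [cb], [ad] for the mixed one, [cd1], [cd2] for the last. *)
have ab1 : a * b = b * b + b * c by rewrite -bE adE mulrDr.
have ab2 : a * b = b * d + b * a by rewrite -bE mulrDr addrC.
have cd1 : c * d = d * d + d * a by rewrite -dE mulrDr addrC.
have cd2 : c * d = d * b + d * c by rewrite -dE adE mulrDr.
(* Multiply [a + d = b + c] by [d] on the right and cancel [d * d]; [cb] arises likewise from
   [b]. *)
have ad : a * d = b * d + d * a.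
  by apply: (addIr (d * d)); rewrite -mulrDl adE mulrDl cd1 addrAC addrA.
have cb : c * b = d * b + b * c.
  by apply: (addrI (b * b)); rewrite -mulrDl -adE mulrDl ab1 addrAC addrA.
(* The term [B] introduced by expanding a coefficient cancels, so both sides of a law reduce to [w]
   minus the same two terms. *)
have comb (w B C D : T) : w - (B + C) - (D - B) = w - (C + D).
  by rewrite -addrA -opprD [B + C]addrC -addrA [B + _]addrC subrK.
split=> /=.
- move=> x; rewrite -!mulrBl; congr (_ * x).
  by apply/eqP; rewrite subr_eq addrAC eq_sym subr_eq adE addrC.
- by move=> y; apply: bijective_affine; exists a'.
- by move=> y; apply: bijective_affine.
- exact: (bijective_2x2 _ _ _ _ _ aa' a'a eV).
- move=> x y z; rewrite !mulrBr !mulrA.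
  have -> : a * b * y = b * b * y + b * c * y by rewrite ab1 mulrDl.
  have -> : a * b * z = b * d * z + b * a * z by rewrite ab2 mulrDl.
  by rewrite !comb [X in _ - X]addrC.
- move=> x y z; rewrite !mulrBr !mulrA caC cb ad !(mulrDl _ _ y) !(mulrDl _ _ z).
  by rewrite !comb [X in _ - X]addrC.
- move=> x y z; rewrite !mulrBr !mulrA.
  have -> : c * d * y = d * d * y + d * a * y by rewrite cd1 mulrDl.
  have -> : c * d * z = d * b * z + d * c * z by rewrite cd2 mulrDl.
  by rewrite !comb [X in _ - X]addrC.
Qed.

(** The topology is Hausdorff: membership in [G n] with [n = deg w + 1] already forces the
    coefficient of [w] to vanish. *)
Lemma G_separated (a b : R) : (forall n, G n (a - b)) -> a = b.
Proof.
move=> h; apply/val_inj/funext => w; apply/eqP; rewrite -subr_eq0.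
by apply: contraT => /(h (deg w).+1); rewrite ltnn.
Qed.

(** The partial sums invert [1 - a] up to [a ^+ n]. This error and the truncation error both lie in
    [G n], for every [n]. *)
Lemma geom_invertible (a : R) :
  G 1 a -> (1 - a) * geom a = 1 /\ geom a * (1 - a) = 1.
Proof.
move=> a1; pose S n := \sum_(k < n) a ^+ k.
have SE n : (1 - a) * S n = 1 - a ^+ n.
  by rewrite -opprB mulNr -subrX1 opprB.
have SC n : S n * (1 - a) = (1 - a) * S n.
  rewrite mulrBr mulrBl mulr1 mul1r mulr_suml mulr_sumr; congr (_ - _).
  by apply: eq_bigr => k _; rewrite -exprSr -exprS.
split; apply: G_separated => n.
  have -> : (1 - a) * geom a - 1 = - ((1 - a) * (S n - geom a)) - a ^+ n.
    by rewrite mulrBr opprB SE -addrA -opprD subrK.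
  by apply: GB; [apply/GN/GMl/geom_trunc|exact: GX].
have -> : geom a * (1 - a) - 1 = - ((S n - geom a) * (1 - a)) - a ^+ n.
  by rewrite mulrBl opprB SC SE -addrA -opprD subrK.
by apply: GB; [apply/GN/GMr/geom_trunc|exact: GX].
Qed.

Lemma invertible_1B (a : R) : G 1 a -> invertible (1 - a).
Proof. by move=> /geom_invertible[]; exists (geom a). Qed.

Lemma G_monom (v : word) : G (deg v) (monom v).
Proof. by move=> w /=; case: (w =P v) => [->|_]; rewrite ?eqxx. Qed.

Lemma toX_relator (a b : R) : relators (a - b) -> toX a = toX b.
Proof. by move=> h; apply/toX_eq/subset_closure => I [_]; apply. Qed.

Lemma XsK : Xs * Xsi = 1.
Proof.
by rewrite -rmorphM -[1](rmorph1 toX); apply: toX_relator; left; left; left.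
Qed.

Lemma XsiK : Xsi * Xs = 1.
Proof.
by rewrite -rmorphM -[1](rmorph1 toX); apply: toX_relator; left; left; right.
Qed.

Lemma Xsu : Xs * Xu = Xu * Xs.
Proof. by rewrite -!rmorphM; apply: toX_relator; left; right. Qed.

Lemma Xst : Xs * Xt * Xsi * (1 + Xt) = (1 - Xu) * Xt.
Proof.
(* In the form [1 - - Rt], this factor cancels [geom (- Rt)]. *)
have -> : 1 + Xt = toX (1 - - Rt) by rewrite rmorphB rmorphN rmorph1 opprK.
have -> : Xs * Xt * Xsi = toX ((1 - Ru) * Rt * geom (- Rt)).
  transitivity (toX (Rs * Rt * Rsi)); first by rewrite !toX_mul.
  by apply: toX_relator; right.
rewrite -rmorphM -(mulrA _ (geom _)).
have [|_ ->] := @geom_invertible (- Rt); first exact/GN/(@G_monom [:: Lt]).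
by rewrite mulr1 rmorphM rmorphB rmorph1.
Qed.

Theorem theorem2p1 :
  biquandle (fun x y : X => Xsi * x - Xsi * (Xu + Xt) * y)
            (fun x y : X => Xsi * (1 - Xu) * x - Xsi * Xt * y).
Proof.
have Gu : G 1 Ru by exact: (@G_monom [:: Lu]).
have Gt : G 1 Rt by exact: (@G_monom [:: Lt]).
have siV : invertible Xsi by exists Xs; [exact: XsiK|exact: XsK].
have uV : invertible (1 - Xu).
  by rewrite -(rmorph1 toX) -rmorphB; apply/invertible_rmorph/invertible_1B.
have tV : invertible (1 + Xt).
  rewrite -(rmorph1 toX) -rmorphD -[Rt]opprK.
  exact/invertible_rmorph/invertible_1B/GN.
have utV : invertible (1 - (Xu + Xt)).
  rewrite -(rmorph1 toX) -rmorphD -rmorphB.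
  exact/invertible_rmorph/invertible_1B/GD.
have siu : Xu * Xsi = Xsi * Xu.
  by rewrite -[LHS]mul1r -XsiK -mulrA (mulrA Xs) Xsu -(mulrA Xu) XsK mulr1.
have siuB : (1 - Xu) * Xsi = Xsi * (1 - Xu).
  by rewrite mulrBl mul1r siu mulrBr mulr1.
have sit : Xt * Xsi * (1 + Xt) = Xsi * (1 - Xu) * Xt.
  by rewrite -(mulrA Xsi) -Xst !mulrA XsiK mul1r.
have adE : Xsi + Xsi * Xt = Xsi * (1 + Xt) by rewrite mulrDr mulr1.
apply: (@linear_biquandle _ _ Xs).
- exact: XsiK.
- exact: XsK.
- exact: invertibleM.
(* With [a' = Xs] the inner [Xs * Xsi] disappears, and [(1 - u) - t (u + t)] factors as
   [(1 + t) (1 - u - t)]. *)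
- have -> : Xsi * (1 - Xu) - Xsi * Xt * Xs * (Xsi * (Xu + Xt)) =
            Xsi * ((1 + Xt) * (1 - (Xu + Xt))).
    rewrite !mulrA -(mulrA _ Xs) XsK mulr1 -!mulrA -mulrBr; congr (_ * _).
    by rewrite mulrDl mul1r mulrBr mulr1 addrA opprD addrA subrK.
  by apply: invertibleM => //; apply: invertibleM.
- by rewrite adE -mulrDr [in RHS]addrAC addrCA addrN addr0 addrC.
- by rewrite -mulrA siuB.
(* After [Xsi] is moved to the left, what remains is [u (1 + t) + (1 - u) t = u + t]. *)
- rewrite adE -!mulrA; congr (_ * _).
  rewrite mulrDl !mulrA siu sit -!mulrA -mulrDr; congr (_ * _).
  by rewrite mulrDr mulr1 mulrBl mul1r addrACA addrN addr0.
- by rewrite adE -!mulrA; congr (_ * _); rewrite !mulrA sit siuB.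
Qed.
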